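(* Let $\mathcal{M} = \langle \mathcal{S}, \mathcal{A}, T, R, \gamma\rangle$ be a goal MDP with goal set $\mathcal{G}$, and let $\langle \bar{\mathcal{M}}, \phi\rangle$ be an abstraction of $\mathcal{M}$, where $\bar{\mathcal{M}} = \langle \bar{\mathcal{S}}, \bar{\mathcal{A}}, \bar{T}, \bar{R}, \bar\gamma\rangle$ is a goal MDP with goal set $\bar{\mathcal{G}}$ satisfying $\mathcal{G} = \bigcup_{\bar s \in \bar{\mathcal{G}}} \phi^{-1}(\bar s)$. Let $\mathcal{M}^b$ be the biased MDP of $\mathcal{M}$ with respect to $\langle \bar{\mathcal{M}}, \phi\rangle$, let $\rho^*$ be an optimal policy of $\mathcal{M}$ and let $\rho^{b*}$ be the optimal policy of $\mathcal{M}^b$. If $\rho^*$ and $\rho^{b*}$ have abstract similarity $\epsilon$, and the abstract value approximation of $\langle \bar{\mathcal{M}}, \phi\rangle$ is $\nu$, then the exploration loss of $\langle \bar{\mathcal{M}}, \phi\rangle$ satisfies $$L(\mathcal{M}, \langle \bar{\mathcal{M}}, \phi\rangle) \le \frac{2\,|\bar{\mathcal{S}}|\,(\epsilon + \gamma\,\nu)}{(1-\gamma)^2}.$$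
   Context: MDPs. An MDP is a tuple $\mathcal{M} = \langle \mathcal{S}, \mathcal{A}, T, R, \gamma\rangle$ with a set of states $\mathcal{S}$, a set of actions $\mathcal{A}$, a transition function $T:\mathcal{S}\times\mathcal{A}\to\Delta(\mathcal{S})$ (where $\Delta(\mathcal{S})$ is the class of probability distributions on $\mathcal{S}$, i.e. $\sum_{s'} T(s,a,s')=1$), a bounded reward function $R:\mathcal{S}\times\mathcal{A}\times\mathcal{S}\to[r_-,r_+]\subset\mathbb{R}$ and discount factor $0<\gamma<1$. A (deterministic) policy is a function $\rho:\mathcal{S}\to\mathcal{A}$. $V^\rho(s)$ is the expected sum of discounted rewards when starting in $s$ and following $\rho$; $V^*(s)=\max_\rho V^\rho(s)$; $Q(s,\rho)$ is another notation for $V^\rho(s)$. Goal MDP. $\mathcal{M}$ is a goal MDP iff there is a set $\mathcal{G}\subseteq\mathcal{S}$ of goal states such that $R(s,a,s')=1$ if $s\notin\mathcal{G}$ and $s'\in\mathcal{G}$, $R(s,a,s')=0$ otherwise, and $V^*(s)=0$ for all $s\in\mathcal{G}$. Abstraction. An abstraction of $\mathcal{M}$ is a pair $\langle\bar{\mathcal{M}},\phi\rangle$ of an MDP $\bar{\mathcal{M}} = \langle \bar{\mathcal{S}}, \bar{\mathcal{A}}, \bar{T}, \bar{R}, \bar\gamma\rangle$ and a function $\phi:\mathcal{S}\to\bar{\mathcal{S}}$. An abstract state $\bar s$ is identified with the block $\phi^{-1}(\bar s)$, so $s\in\bar s$ means $\phi(s)=\bar s$. Biased MDP. The biased MDP $\mathcal{M}^b$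 of $\mathcal{M}$ with respect to $\langle\bar{\mathcal{M}},\phi\rangle$ is $\langle\mathcal{S},\mathcal{A},T,R^b,\gamma\rangle$ with $R^b(s,a,s') = R(s,a,s')+\gamma\,\Phi(s')-\Phi(s)$ and $\Phi(s)=\bar V^*(\phi(s))$, where $\bar V^*$ is the optimal value function of $\bar{\mathcal{M}}$. Exploration loss. $L(\mathcal{M},\langle\bar{\mathcal{M}},\phi\rangle) = \max_{s\in\mathcal{S}} |V^*(s)-Q(s,\rho^{b*})|$, where $V^*$ and $Q(\cdot,\rho^{b*})=V^{\rho^{b*}}$ are both values in $\mathcal{M}$ (not in $\mathcal{M}^b$) and $\rho^{b*}$ is the optimal policy of $\mathcal{M}^b$. Abstract similarity. For a policy $\rho$, $s\in\mathcal{S}$, $\bar s'\in\bar{\mathcal{S}}\setminus\{\phi(s)\}$ and $k\in\mathbb{N}$ (including $0$), $p(\bar s',k\mid s,\rho)$ denotes the probability, starting from $s$ and following $\rho$ in $\mathcal{M}$, of the event of remaining for $k$ steps in the block of $s$ and then reaching some $s'\in\bar s'$ at the next transition. Two policies $\rho_1,\rho_2$ have abstract similarity $\epsilon$ if for all $s\in\mathcal{S}$, $\bar s'\in\bar{\mathcal{S}}\setminus\{\phi(s)\}$ and $k\in\mathbb{N}$, $|p(\bar s',k\mid s,\rho_1)-p(\bar s',k\mid s,\rho_2)|\le\epsilon$. Abstract value approximation. It is the smallest $\nu\ge 0$ such that there exists a function $W_\nu:\bar{\mathcal{S}}\times\bar{\mathcal{S}}\to\mathbb{R}$ which, for all $\bar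 s,\bar s'\in\bar{\mathcal{S}}$, $s\in\bar s$, $s'\in\bar s'$ and $a\in\mathcal{A}$, satisfies: if $T(s,a,s')>0$ then $|W_\nu(\bar s,\bar s')-V^*(s')|\le\nu$ (with $V^*$ the optimal value function of $\mathcal{M}$). *)

(* Defs.v *)
From HB Require Import structures.
From mathcomp Require Import all_boot all_order all_algebra.
From mathcomp Require Import lra.
From mathcomp Require Import all_classical all_reals all_analysis.

Set Implicit Arguments.
Unset Strict Implicit.
Unset Printing Implicit Defensive.

Import Order.TTheory GRing.Theory Num.Theory.
Import numFieldNormedType.Exports.

Local Open Scope classical_set_scope.
Local Open Scope ring_scope.

(* The state space is an arbitrary set, so sums over states are unordered
   sums.  As [esum] is only meaningful for nonnegative terms, the positive and
   negative parts are summed separately. *)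
Definition dsum (R : realType) (S : choiceType) (f : S -> R) : R :=
  fine (\esum_(x in [set: S]) ((EFin \o f)^\+%E x)
        - \esum_(x in [set: S]) ((EFin \o f)^\-%E x))%E.

Record mdp (R : realType) (S : choiceType) (A : Type) := Mdp {
  trans : S -> A -> S -> R ;
  reward : S -> A -> S -> R ;
  discount : R ;
  rmin : R ;
  rmax : R ;
  trans_ge0 : forall s a s', 0 <= trans s a s' ;
  trans_sum1 : forall s a, (\esum_(s' in [set: S]) (trans s a s')%:E = 1)%E ;
  reward_bounded : forall s a s', rmin <= reward s a s' <= rmax ;
  discount_gt0 : 0 < discount ;
  discount_lt1 : discount < 1
}.

Section Values.
Context (R : realType) (S : choiceType) (A : Type).
Implicit Types (M : mdp R S A) (rho : S -> A) (s : S).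

(* [expect M rho n s f] is E[f(s_1, ..., s_n)], where s_0 = s and s_{t+1} is
   drawn from T(s_t, rho(s_t), .): the finite-dimensional laws of the Markov
   chain are iterated expectations. *)
Fixpoint expect M rho (n : nat) s (f : seq S -> R) : R :=
  if n is m.+1 then
    dsum (fun s' => trans M s (rho s) s' *
                    expect M rho m s' (fun w => f (s' :: w)))
  else f [::].

Definition prob M rho (n : nat) s (E : pred (seq S)) : R :=
  expect M rho n s (fun w => (E w)%:R).

(* Here w = (s_1, ..., s_n), and [nth s (s :: w) t] is s_t. *)
Definition discounted_return M rho s (w : seq S) : R :=
  \sum_(t < size w)
    discount M ^+ t * reward M (nth s (s :: w) t) (rho (nth s (s :: w) t))
                               (nth s (s :: w) t.+1).

(* Rewards being bounded and the discount smaller than 1, the returns over the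
   first n steps converge uniformly as n grows, so that the limit below is the
   expected return over the infinite horizon. *)
Definition value M rho s : R :=
  lim ((fun n => expect M rho n s (discounted_return M rho s)) @ \oo).

(* The values of policies are bounded, so this is a genuine supremum; it is a
   maximum as soon as an optimal policy in the sense below exists. *)
Definition opt_value M s : R := sup [set value M rho s | rho in [set: S -> A]].

Definition optimal_policy M rho : Prop :=
  forall s, value M rho s = opt_value M s.

Definition goal_mdp M (G : set S) : Prop :=
  (forall s a s', reward M s a s' = ((s \notin G) && (s' \in G))%:R) /\
  (forall s, G s -> opt_value M s = 0).

(* The exploration loss of an abstraction is obtained at rho = rho^{b*}, an
   optimal policy of the biased MDP, while the values remain those of M.  On an
   infinite state space the maximum is read as a supremum (of a bounded set). *)
Definition exploration_loss M rho : R :=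
  sup [set `|opt_value M s - value M rho s| | s in [set: S]].

End Values.

Section Abstraction.
Context (R : realType) (S : choiceType) (A : Type) (Sb : finType) (Ab : Type).
Context (M : mdp R S A) (Mb : mdp R Sb Ab) (phi : S -> Sb).

Definition potential (s : S) : R := opt_value Mb (phi s).

Definition biased_reward (s : S) (a : A) (s' : S) : R :=
  reward M s a s' + discount M * potential s' - potential s.

Let bound : R := \sum_(sb : Sb) `|opt_value Mb sb|.

Lemma biased_reward_bounded s a s' :
  rmin M - bound - bound <= biased_reward s a s' <= rmax M + bound + bound.
Proof.
have B x : `|potential x| <= bound.
  rewrite /bound (bigD1 (phi x)) //= lerDl.
  by apply: sumr_ge0 => i _; exact: normr_ge0.
have /andP[r1 r2] := reward_bounded M s a s'.
have := B s; rewrite ler_norml => /andP[b1 b2].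
have : `|discount M * potential s'| <= bound.
  rewrite normrM (ger0_norm (ltW (discount_gt0 M))).
  apply: le_trans (B s').
  by apply: ler_piMl; [exact: normr_ge0 | exact: ltW (discount_lt1 M)].
rewrite ler_norml => /andP[c1 c2].
by apply/andP; rewrite /biased_reward; split; lra.
Qed.

Definition biased_mdp : mdp R S A :=
  Mdp (trans_ge0 M) (trans_sum1 M) biased_reward_bounded
      (discount_gt0 M) (discount_lt1 M).

(* p(sb', k | s, rho): s_1, ..., s_k lie in the block of s and s_{k+1} lies
   in sb'. *)
Definition exit_prob (rho : S -> A) (s : S) (sb' : Sb) (k : nat) : R :=
  prob M rho k.+1 s (fun w =>
    all (fun x => phi x == phi s) (take k w) && (phi (nth s w k) == sb')).

Definition abstract_similarity (rho1 rho2 : S -> A) (eps : R) : Prop :=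
  forall (s : S) (sb' : Sb) (k : nat), sb' != phi s ->
    `|exit_prob rho1 s sb' k - exit_prob rho2 s sb' k| <= eps.

Definition approximates_value (nu : R) : Prop :=
  0 <= nu /\
  exists W : Sb -> Sb -> R,
    forall (sb sb' : Sb) (s s' : S) (a : A), phi s = sb -> phi s' = sb' ->
      0 < trans M s a s' -> `|W sb sb' - opt_value M s'| <= nu.

Definition abstract_value_approximation (nu : R) : Prop :=
  approximates_value nu /\
  forall nu', approximates_value nu' -> nu <= nu'.

End Abstraction.

(* Main.v *)
(* Split a run from a state s outside the goal at the first exit from the block
   b of s: for every policy, V(s) is the sum over k and c <> b of gamma^k times
   the expectation, on the event that the run stays k steps in b and then enters
   c, of the entry value 1_G + gamma V.  With V the optimal value, the entry
   value is within gamma nu of a constant of [0, 1] depending only on b and c,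
   so changing the policy inside b costs at most eps + 2 gamma nu for each pair
   (k, c); changing the continuation costs at most gamma D in total, where D is
   the loss, since the exit probabilities sum to at most 1.  Hence
   D <= |Sb| (eps + 2 gamma nu) / (1 - gamma) + gamma D. *)
Require Import Defs.
From mathcomp Require Import all_boot all_order all_algebra.
From mathcomp Require Import ring lra.
From mathcomp Require Import all_classical all_reals all_analysis.

Import Order.TTheory GRing.Theory Num.Theory.
Import numFieldNormedType.Exports.

Local Open Scope classical_set_scope.
Local Open Scope ring_scope.

(** * Linearity of unordered sums of real families *)

Section Dsum.
#[local] Set Implicit Arguments.
#[local] Unset Strict Implicit.
Context {R : realType} {S : choiceType}.
Implicit Types (f g u v : S -> R).

(** Outside this class [dsum] may be the default that [fine] gives to an infinite value; linearity
    is proved within it. *)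
Definition abs_summable f : Prop := summable [set: S] (EFin \o f).

Lemma abs_summable_le f g :
  (forall x, `|f x| <= `|g x|) -> abs_summable g -> abs_summable f.
Proof.
by move=> fg; apply: le_lt_trans; apply: le_esum => x _; rewrite /= lee_fin.
Qed.

Lemma abs_summableD f g :
  abs_summable f -> abs_summable g -> abs_summable (fun x => f x + g x).
Proof. exact: summableD. Qed.

Lemma ge0_abs_summableE u : (forall x, 0 <= u x) -> abs_summable u ->
  (\esum_(x in [set: S]) (u x)%:E \is a fin_num)%E.
Proof.
move=> u0 su; rewrite (@eq_esum _ _ _ _ (abse \o (EFin \o u))).
  by rewrite -summableE.
by move=> x _ /=; rewrite ger0_norm.
Qed.

(** Any splitting into summable nonnegative families computes [dsum], not only the one into positive
    and negative parts; linearity then reduces to that of [esum]. *)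
Lemma dsumB u v : (forall x, 0 <= u x) -> (forall x, 0 <= v x) ->
  abs_summable u -> abs_summable v ->
  dsum (fun x => u x - v x) = fine (\esum_(x in [set: S]) (u x)%:E)
                            - fine (\esum_(x in [set: S]) (v x)%:E).
Proof.
move=> u0 v0 su sv.
rewrite -fineB ?ge0_abs_summableE// -(esumB su sv)// => x _;
  by rewrite lee_fin.
Qed.

Lemma dsum_ge0 u : (forall x, 0 <= u x) -> 0 <= dsum u.
Proof.
move=> u0; rewrite /dsum.
rewrite [X in (_ - X)%E]esum1 ?sube0; last first.
  by move=> x _; rewrite funenegE; apply/max_idPr; rewrite leeNl oppe0 lee_fin.
by apply: fine_ge0; apply: esum_ge0 => x _; exact: funepos_ge0.
Qed.

Lemma ge0_dsum u : (forall x, 0 <= u x) -> abs_summable u ->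
  dsum u = fine (\esum_(x in [set: S]) (u x)%:E).
Proof.
move=> u0 su; have s0 : abs_summable (fun _ : S => 0).
  by apply: abs_summable_le su => x; rewrite normr0.
have := dsumB u0 (fun=> lexx 0) su s0.
under eq_fun do rewrite subr0; move=> ->.
by rewrite [X in _ - fine X]esum1 ?subr0.
Qed.

Lemma real_posneg f x : f x = Num.max (f x) 0 - Num.max (- f x) 0.
Proof.
have [f0|/ltW f0] := leP (f x) 0.
  by rewrite (max_l (_ : 0 <= - f x)) ?oppr_ge0// sub0r opprK.
by rewrite (max_r (_ : - f x <= 0)) ?oppr_le0// subr0.
Qed.

Lemma abs_summable_posneg f : abs_summable f ->
  abs_summable (fun x => Num.max (f x) 0) /\
  abs_summable (fun x => Num.max (- f x) 0).
Proof.
move=> sf; split; apply: abs_summable_le sf => x.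
  by case: (leP (f x) 0) => *; rewrite ?normr0 ?normr_ge0.
by case: (leP (- f x) 0) => *; rewrite ?normrN ?normr0 ?normr_ge0.
Qed.

Lemma max0r_ge0 (r : R) : 0 <= Num.max r 0.
Proof. by rewrite le_max lexx orbT. Qed.

Lemma dsumD f g : abs_summable f -> abs_summable g ->
  dsum (fun x => f x + g x) = dsum f + dsum g.
Proof.
move=> sf sg; have [sfp sfn] := abs_summable_posneg sf.
have [sgp sgn] := abs_summable_posneg sg.
(* The positive part of a sum is not the sum of the positive parts, but the latter still gives a
   splitting that [dsumB] accepts. *)
have -> : (fun x => f x + g x) = (fun x =>
    (Num.max (f x) 0 + Num.max (g x) 0)
    - (Num.max (- f x) 0 + Num.max (- g x) 0)).
  by apply/funext => x; rewrite [in LHS](real_posneg f) [in LHS](real_posneg g);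
    ring.
rewrite [in dsum f](funext (real_posneg f)) [in dsum g](funext (real_posneg g)).
have p0 (h : S -> R) x : 0 <= Num.max (h x) 0 by exact: max0r_ge0.
have pN0 (h : S -> R) x : 0 <= Num.max (- h x) 0 by exact: max0r_ge0.
have esumDE (u v : S -> R) : (forall x, 0 <= u x) -> (forall x, 0 <= v x) ->
    abs_summable u -> abs_summable v ->
    fine (\esum_(x in [set: S]) (u x + v x)%:E) =
    fine (\esum_(x in [set: S]) (u x)%:E) +
    fine (\esum_(x in [set: S]) (v x)%:E).
  move=> u0 v0 su sv; rewrite -fineD ?ge0_abs_summableE// -esumD//;
    by move=> x _; rewrite lee_fin.
rewrite (dsumB (p0 f) (pN0 f))// (dsumB (p0 g) (pN0 g))//.
rewrite (@dsumB (fun x => Num.max (f x) 0 + Num.max (g x) 0)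
  (fun x => Num.max (- f x) 0 + Num.max (- g x) 0)); first last.
- exact: abs_summableD.
- exact: abs_summableD.
- by move=> x; rewrite addr_ge0.
- by move=> x; rewrite addr_ge0.
rewrite !esumDE//; ring.
Qed.

Lemma dsumN f : abs_summable f -> dsum (fun x => - f x) = - dsum f.
Proof.
move=> sf; have [sfp sfn] := abs_summable_posneg sf.
have -> : (fun x => - f x) = (fun x => Num.max (- f x) 0 - Num.max (f x) 0).
  by apply/funext => x; rewrite {1}(real_posneg f) opprB.
rewrite [in RHS](funext (real_posneg f)).
by rewrite !dsumB ?opprB// => x; exact: max0r_ge0.
Qed.

Lemma esum_scale (a : R) u : 0 <= a -> (forall x, 0 <= u x) ->
  (\esum_(x in [set: S]) (a * u x)%:E =
   a%:E * \esum_(x in [set: S]) (u x)%:E)%E.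
Proof.
move=> a0 u0; rewrite /esum -ereal_supZl//; last first.
  by apply/set0P; exists (\sum_(x \in set0) (u x)%:E)%E; exists set0 => //;
    exact: fsets_set0.
congr ereal_sup; rewrite image_comp; apply: eq_imagel => F _ /=.
rewrite ge0_mule_fsumr; last by move=> x; rewrite lee_fin.
by apply: eq_fsbigr => x _; rewrite EFinM.
Qed.

Lemma abs_summableZ (a : R) f :
  abs_summable f -> abs_summable (fun x => a * f x).
Proof.
move=> sf; rewrite /abs_summable /summable.
rewrite (@eq_esum _ _ _ _ (fun x => (`|a| * `|f x|)%:E)); last first.
  by move=> x _ /=; rewrite normrM.
by rewrite esum_scale// lte_mul_pinfty.
Qed.

Lemma ge0_dsumZ (a : R) f : 0 <= a -> abs_summable f ->
  dsum (fun x => a * f x) = a * dsum f.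
Proof.
move=> a0 sf; have [sfp sfn] := abs_summable_posneg sf.
have -> : (fun x => a * f x) =
    (fun x => a * Num.max (f x) 0 - a * Num.max (- f x) 0).
  by apply/funext => x; rewrite {1}(real_posneg f) mulrBr.
rewrite [in RHS](funext (real_posneg f)).
rewrite !dsumB//; try (exact: abs_summableZ); try (move=> x; exact: max0r_ge0);
  try by move=> x; rewrite mulr_ge0// max0r_ge0.
rewrite !esum_scale//; try (move=> x; exact: max0r_ge0).
by rewrite !fineM ?mulrBr// ge0_abs_summableE// => x; exact: max0r_ge0.
Qed.

Lemma dsumZ (a : R) f : abs_summable f ->
  dsum (fun x => a * f x) = a * dsum f.
Proof.
move=> sf; have [a0|/ltW a0] := leP 0 a; first exact: ge0_dsumZ.
have -> : (fun x => a * f x) = (fun x => - (- a * f x)).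
  by apply/funext => x; rewrite mulNr opprK.
by rewrite dsumN ?ge0_dsumZ ?oppr_ge0 ?mulNr ?opprK//; exact: abs_summableZ.
Qed.

End Dsum.

(** * Bounded real functions *)

Section Bounded.
#[local] Set Implicit Arguments.
#[local] Unset Strict Implicit.
Context {R : realType} {S : Type}.
Implicit Types f g : S -> R.

Definition bounded_real f : Prop := exists C, forall x, `|f x| <= C.

Lemma bounded_real_itv f a b : (forall x, a <= f x <= b) -> bounded_real f.
Proof.
move=> fab; exists (`|a| + `|b|) => x; have /andP[af fb] := fab x.
have := ler_norm b; have := ler_norm (- a); rewrite normrN => h1 h2.
have := normr_ge0 a; have := normr_ge0 b => h3 h4.
by rewrite ler_norml; apply/andP; split; lra.
Qed.

Lemma bounded_real_cst c : bounded_real (fun _ : S => c).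
Proof. by exists `|c|. Qed.

Lemma bounded_realD f g : bounded_real f -> bounded_real g ->
  bounded_real (fun x => f x + g x).
Proof.
move=> [C fC] [D gD]; exists (C + D) => x.
by apply: le_trans (ler_normD _ _) _; rewrite lerD.
Qed.

Lemma bounded_realM f g : bounded_real f -> bounded_real g ->
  bounded_real (fun x => f x * g x).
Proof.
move=> [C fC] [D gD]; exists (C * D) => x.
by rewrite normrM ler_pM.
Qed.

Lemma bounded_real_nat (b : S -> bool) : bounded_real (fun x => (b x)%:R).
Proof. by exists 1 => x; case: (b x); rewrite ?normr1 ?normr0. Qed.

Lemma bounded_real_sum (I : finType) (P : pred I) (F : I -> S -> R) :
  (forall i, bounded_real (F i)) ->
  bounded_real (fun x => \sum_(i | P i) F i x).
Proof.
move=> bF; have /choice[C FC] := bF; exists (\sum_(i | P i) C i) => x.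
by apply: le_trans (ler_norm_sum _ _ _) _; apply: ler_sum.
Qed.

End Bounded.
#[local] Hint Resolve bounded_real_cst bounded_realD bounded_realM
  bounded_real_nat : core.

(** * The one-step expectation operator of a policy *)

Section Next.
#[local] Set Implicit Arguments.
#[local] Unset Strict Implicit.
Context {R : realType} {S : choiceType} {A : Type}.
Variables (M : mdp R S A) (rho : S -> A).
Implicit Types (f g : S -> R) (x y : S).

Definition next f x : R := dsum (fun y => trans M x (rho x) y * f y).

Let weight x y := trans M x (rho x) y.

Lemma abs_summable_weight x : abs_summable (weight x).
Proof.
rewrite /abs_summable /summable (@eq_esum _ _ _ _ (EFin \o weight x)).
  by rewrite [ltLHS](trans_sum1 M x (rho x)) ltry.
by move=> y _ /=; rewrite ger0_norm// /weight trans_ge0.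
Qed.

Lemma abs_summable_next f x : bounded_real f ->
  abs_summable (fun y => trans M x (rho x) y * f y).
Proof.
move=> [C fC]; apply: abs_summable_le (abs_summableZ C (abs_summable_weight x)).
move=> y; rewrite mulrC !normrM ler_wpM2r//.
exact: le_trans (fC y) (ler_norm C).
Qed.

Lemma next_ext f g x : f =1 g -> next f x = next g x.
Proof. by move=> /funext ->. Qed.

Lemma next_cst c x : next (fun=> c) x = c.
Proof.
rewrite /next; under eq_fun do rewrite mulrC.
rewrite (dsumZ c (abs_summable_weight x)) ge0_dsum ?trans_sum1 ?mulr1//.
- by move=> y; exact: trans_ge0.
- exact: abs_summable_weight.
Qed.

Lemma nextD f g x : bounded_real f -> bounded_real g ->
  next (fun y => f y + g y) x = next f x + next g x.
Proof.
move=> bf bg; rewrite /next; under eq_fun do rewrite mulrDr.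
by rewrite dsumD//; exact: abs_summable_next.
Qed.

Lemma nextZ c f x : bounded_real f -> next (fun y => c * f y) x = c * next f x.
Proof.
move=> bf; rewrite /next; under eq_fun do rewrite mulrCA.
by rewrite dsumZ//; exact: abs_summable_next.
Qed.

Lemma nextB f g x : bounded_real f -> bounded_real g ->
  next (fun y => f y - g y) x = next f x - next g x.
Proof.
move=> bf bg; under [X in next X]eq_fun do rewrite -mulN1r.
by rewrite nextD// ?nextZ ?mulN1r//; exact: bounded_realM.
Qed.

Lemma next_sum (I : finType) (P : pred I) (F : I -> S -> R) x :
  (forall i, bounded_real (F i)) ->
  next (fun y => \sum_(i | P i) F i y) x = \sum_(i | P i) next (F i) x.
Proof.
(* Boundedness of the partial sums is carried along in the induction, since additivity requires
   it. *)
move=> bF; pose lin (r : seq I) := next (fun y => \sum_(i <- r | P i) F i y) x =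
  \sum_(i <- r | P i) next (F i) x.
suff [_ //] : bounded_real (fun y => \sum_(i <- index_enum I | P i) F i y) /\
    lin (index_enum I).
elim: index_enum => [|i r [br IHr]]; rewrite /lin.
  by rewrite (funext (fun y => big_nil _ _ _ _)) next_cst big_nil; split.
rewrite (funext (fun y => big_cons _ _ _ _ _ _)) big_cons.
by case: ifP => // _; rewrite nextD// IHr; split; auto.
Qed.

(** Only successors of positive probability carry weight, which matches the value approximation: it
    constrains [W] along possible transitions only. *)
Lemma ler_next f g x : bounded_real f -> bounded_real g ->
  (forall y, 0 < trans M x (rho x) y -> f y <= g y) -> next f x <= next g x.
Proof.
move=> bf bg fg; rewrite -subr_ge0 -nextB//; apply: dsum_ge0 => y.
have := trans_ge0 M x (rho x) y; rewrite le_eqVlt => /predU1P[<-|T0].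
  by rewrite mul0r.
by rewrite mulr_ge0 ?subr_ge0 ?fg// ltW.
Qed.

Lemma bounded_real_next f : bounded_real f -> bounded_real (next f).
Proof.
move=> bf; have [C fC] := bf; exists C => x; rewrite ler_norml; apply/andP.
have fCN y : - C <= f y <= C by rewrite -ler_norml.
by split; [rewrite -(next_cst (- C) x)|rewrite -(next_cst C x)];
  apply: ler_next => // y _; have /andP[] := fCN y.
Qed.

End Next.

(** * Values as limits of finite-horizon returns, and the Bellman equation *)

Section Value.
#[local] Set Implicit Arguments.
#[local] Unset Strict Implicit.
Context {R : realType} {S : choiceType} {A : Type}.
Variables (M : mdp R S A) (rho : S -> A).
Local Notation gamma := (discount M).
Implicit Types (x y s : S) (w : seq S).

Lemma expectS n s (F : seq S -> R) :
  expect M rho n.+1 s F =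
  next M rho (fun y => expect M rho n y (fun w => F (y :: w))) s.
Proof. by []. Qed.

Lemma ler_norm_expect n s (F : seq S -> R) C :
  (forall w, `|F w| <= C) -> `|expect M rho n s F| <= C.
Proof.
elim: n s F => [|n IHn] s F FC; first exact: FC.
have eC y : `|expect M rho n y (fun w => F (y :: w))| <= C by exact: IHn.
have be : bounded_real (fun y => expect M rho n y (fun w => F (y :: w))).
  by exists C.
rewrite ler_norml -{1}(next_cst M rho (- C) s) -{2}(next_cst M rho C s).
by apply/andP; split; apply: ler_next => // y _;
  have := eC y; rewrite ler_norml => /andP[].
Qed.

Lemma bounded_real_expect n (F : S -> seq S -> R) C :
  (forall s w, `|F s w| <= C) -> bounded_real (fun s => expect M rho n s (F s)).
Proof. by move=> FC; exists C => s; exact: ler_norm_expect. Qed.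

(** The affine form serves two purposes: a return is the first reward plus a discounted return, and
    an indicator decided by the first step factors out with [a = 0]. *)
Lemma expect_affine n s (F : seq S -> R) a c : bounded_real F ->
  expect M rho n s (fun w => a + c * F w) = a + c * expect M rho n s F.
Proof.
elim: n s F => [//|n IHn] s F [C FC] /=.
have be : bounded_real (fun y => expect M rho n y (fun w => F (y :: w))).
  by apply: (@bounded_real_expect _ (fun y w => F (y :: w)) C).
rewrite -[X in X + _](next_cst M rho a s) -nextZ// -nextD//; last first.
  exact: bounded_realM.
congr dsum; apply/funext => y; congr (_ * _).
by rewrite (IHn _ (fun w => F (y :: w)))//; exists C.
Qed.

Lemma discounted_return_cons s y w :
  discounted_return M rho s (y :: w) =
  reward M s (rho s) y + gamma * discounted_return M rho y w.
Proof.
rewrite /discounted_return big_ord_recl/= expr0 mul1r; congr (_ + _).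
rewrite mulr_sumr; apply: eq_bigr => i _; rewrite /bump/= add1n exprS.
(* The two returns use different defaults, [s] and [y]; all indices are in range, so either may be
   taken. *)
rewrite (set_nth_default y s (_ : (i < size (y :: w))%N)) ?ltnS 1?ltnW//.
by rewrite (set_nth_default y s (ltn_ord i)) mulrA.
Qed.

Hypothesis reward01 : forall s a s', 0 <= reward M s a s' <= 1.

Let gamma0 : 0 < gamma := discount_gt0 M.
Let gamma1 : gamma < 1 := discount_lt1 M.

(** The sum of the geometric series, which bounds every return with rewards in [0, 1]; it is used
    through its fixed-point equation. *)
Let K : R := (1 - gamma)^-1.

Let K_eq : 1 + gamma * K = K.
Proof. by rewrite /K; field; rewrite gt_eqF// subr_gt0. Qed.

Let K_ge0 : 0 <= K.
Proof. by rewrite invr_ge0 subr_ge0 ltW. Qed.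

Lemma discounted_return_itv s w : 0 <= discounted_return M rho s w <= K.
Proof.
elim: w s => [|y w IHw] s; first by rewrite /discounted_return big_ord0 lexx.
have /andP[r0 rK] := IHw y; have /andP[R0 R1] := reward01 s (rho s) y.
rewrite discounted_return_cons addr_ge0 ?mulr_ge0 ?(ltW gamma0)//= -K_eq.
by rewrite lerD// ler_wpM2l// ltW.
Qed.

Let bounded_return s : bounded_real (discounted_return M rho s).
Proof. by apply: bounded_real_itv => w; exact: discounted_return_itv. Qed.

Let V n s := expect M rho n s (discounted_return M rho s).

Let bounded_V n : bounded_real (V n).
Proof.
apply: (@bounded_real_expect _ _ K) => s w.
by have /andP[r0 rK] := discounted_return_itv s w; rewrite ger0_norm.
Qed.

Lemma bounded_real_reward s a : bounded_real (reward M s a).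
Proof. by apply: bounded_real_itv => s'; exact: reward01. Qed.
Hint Resolve bounded_V bounded_real_reward : core.

Let V0 s : V 0 s = 0.
Proof. by rewrite /V /= /discounted_return big_ord0. Qed.

Let VS n s : V n.+1 s =
  next M rho (fun y => reward M s (rho s) y + gamma * V n y) s.
Proof.
rewrite /V /=; congr dsum; apply/funext => y; congr (_ * _).
by rewrite (funext (discounted_return_cons s y)) expect_affine.
Qed.

Let bounded_step n s :
  bounded_real (fun y => reward M s (rho s) y + gamma * V n y).
Proof. by apply: bounded_realD => //; exact: bounded_realM. Qed.
Hint Resolve bounded_step : core.

Let V_mono n s : V n s <= V n.+1 s.
Proof.
elim: n s => [|n IHn] s; rewrite [leRHS]VS.
  rewrite V0 -[leLHS](next_cst M rho 0 s); apply: ler_next => // y _.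
  by rewrite V0 mulr0 addr0; have /andP[] := reward01 s (rho s) y.
rewrite VS; apply: ler_next => // y _.
by rewrite lerD2l ler_wpM2l// ltW.
Qed.

Let V_le n s : V n s <= K.
Proof.
have := @ler_norm_expect n s (discounted_return M rho s) K.
move=> /(_ _)/ler_normlW; apply=> w.
by have /andP[r0 rK] := discounted_return_itv s w; rewrite ger0_norm.
Qed.

(** Both horizons share their first [n] steps; the rest is discounted by [gamma ^+ n] and worth at
    most [K]. *)
Let V_cauchy n m s : V (n + m) s <= V n s + gamma ^+ n * K.
Proof.
elim: n s => [|n IHn] s; first by rewrite add0n V0 add0r expr0 mul1r V_le.
rewrite addSn !VS -[X in _ <= _ + X](next_cst M rho _ s) -nextD//.
apply: ler_next => // [|y _]; first exact: bounded_realD.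
by rewrite -addrA lerD2l exprS -mulrA -mulrDr ler_wpM2l// ltW.
Qed.

Let V_nondecreasing s : nondecreasing_seq (V ^~ s).
Proof. by apply/nondecreasing_seqP => n; exact: V_mono. Qed.

Let is_cvg_V s : cvgn (V ^~ s).
Proof.
apply: nondecreasing_is_cvgn => //.
by exists K => _ [n _ <-]; exact: V_le.
Qed.

Let V_le_value n s : V n s <= value M rho s.
Proof. exact: (nondecreasing_cvgn_le (@V_nondecreasing s) (@is_cvg_V s)). Qed.

Let value_le_V n s : value M rho s <= V n s + gamma ^+ n * K.
Proof.
apply: limr_le; first exact: is_cvg_V.
near=> m; rewrite -(@subnKC n m); first exact: V_cauchy.
by near: m; exact: nbhs_infty_ge.
Unshelve. all: by end_near. Qed.

Lemma value_itv s : 0 <= value M rho s <= (1 - gamma)^-1.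
Proof.
rewrite -{1}(V0 s) V_le_value/=.
by have := value_le_V 0 s; rewrite V0 add0r expr0 mul1r.
Qed.

Lemma bounded_real_value : bounded_real (value M rho).
Proof. by apply: bounded_real_itv; exact: value_itv. Qed.

(** Sends the horizon to infinity in inequalities whose error decays like [gamma ^+ n]. *)
Lemma le_discount_limit (x a c : R) :
  (forall n, x <= a + gamma ^+ n * c) -> x <= a.
Proof.
move=> xac; have cv : (fun n => a + gamma ^+ n * c) @ \oo --> a.
  rewrite -[X in _ --> X]addr0 -(mul0r c).
  apply: cvgD; first exact: cvg_cst.
  by apply: cvgMl; apply: cvg_expr; rewrite ger0_norm// ltW.
have <- := cvg_lim (@Rhausdorff R) cv.
apply: limr_ge; [exact: (cvgP _ cv)|exact: nearW].
Qed.

(** No limit is exchanged with the sum over states: for every [n] both sides lie between [V n.+1 s]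
    and [V n.+1 s + gamma ^+ n.+1 * K]. *)
Lemma value_bellman s :
  value M rho s =
  next M rho (fun y => reward M s (rho s) y + gamma * value M rho y) s.
Proof.
have bgv : bounded_real (fun y => gamma * value M rho y).
  by apply: bounded_realM => //; exact: bounded_real_value.
set B := RHS; have VB n : V n.+1 s <= B.
  rewrite VS; apply: ler_next => // [|y _]; first exact: bounded_realD.
  by rewrite lerD2l ler_wpM2l ?(ltW gamma0).
have BV n : B <= V n.+1 s + gamma ^+ n.+1 * K.
  rewrite VS -[X in _ <= _ + X](next_cst M rho _ s) -nextD//.
  apply: ler_next => // [||y _]; [exact: bounded_realD|exact: bounded_realD|].
  by rewrite -addrA lerD2l exprS -mulrA -mulrDr ler_wpM2l ?(ltW gamma0).
by apply/le_anti/andP; split; apply: (@le_discount_limit _ _ (gamma * K)) => n;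
  rewrite mulrA -exprSr; [apply: le_trans (value_le_V n.+1 s) _
  |apply: le_trans (BV n) _]; rewrite lerD2r.
Qed.

End Value.

(** * Values in a goal MDP *)

Section GoalValue.
#[local] Set Implicit Arguments.
#[local] Unset Strict Implicit.
Context {R : realType} {S : choiceType} {A : Type}.
Variables (M : mdp R S A) (G : set S).
Hypothesis goalM : goal_mdp M G.
Local Notation gamma := (discount M).

Lemma goal_reward01 s a s' : 0 <= reward M s a s' <= 1.
Proof. by rewrite goalM.1 ler0n lern1 leq_b1. Qed.

Lemma goal_value_le_opt rho s : value M rho s <= opt_value M s.
Proof.
apply: ub_le_sup; last by exists rho.
by exists (1 - gamma)^-1 => _ [rho' _ <-];
  have /andP[] := value_itv rho' goal_reward01 s.
Qed.

(** Values are nonnegative and at most the optimal value, which vanishes on the goal. *)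
Lemma goal_value0 rho s : G s -> value M rho s = 0.
Proof.
move=> Gs; apply/le_anti.
have /andP[-> _] := value_itv rho goal_reward01 s.
by rewrite andbT -[leRHS](goalM.2 s Gs) goal_value_le_opt.
Qed.

(** The reward 1 is paid on entering the goal, where the continuation is worth 0. Iterating the
    Bellman equation from the crude bound [(1 - gamma)^-1] leaves, after [n] rounds, an excess over
    1 of at most [gamma ^+ n * (1 - gamma)^-1]. *)
Lemma goal_value_le1 rho s : value M rho s <= 1.
Proof.
have g0 := ltW (discount_gt0 M); have g1 := ltW (discount_lt1 M).
have K0 : 0 <= (1 - gamma)^-1 by rewrite invr_ge0 subr_ge0.
have bV := bounded_real_value rho goal_reward01.
apply: (@le_discount_limit _ _ _ M _ _ (1 - gamma)^-1) => n.
elim: n s => [|n IHn] s.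
  have /andP[_ /le_trans->//] := value_itv rho goal_reward01 s.
  by rewrite expr0 mul1r lerDr.
rewrite (value_bellman _ goal_reward01) -[leRHS](next_cst M rho _ s).
apply: ler_next => // [|y _].
  apply: bounded_realD; last exact: bounded_realM.
  exact: bounded_real_reward goal_reward01 _ _.
have r0 : 0 <= gamma ^+ n.+1 * (1 - gamma)^-1 by rewrite mulr_ge0// exprn_ge0.
have [Gy|nGy] := pselect (G y).
  rewrite goal_value0// mulr0 addr0.
  by have /andP[_ /le_trans->//] := goal_reward01 s (rho s) y; rewrite lerDl.
rewrite goalM.1 (memNset nGy) andbF add0r.
apply: le_trans (ler_wpM2l g0 (IHn y)) _.
by rewrite mulrDr mulr1 mulrA -exprS lerD2r.
Qed.

End GoalValue.

(** * Runs confined to a block *)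

Section Blocks.
#[local] Set Implicit Arguments.
#[local] Unset Strict Implicit.
Context {R : realType} {S : choiceType} {A : Type} {Sb : finType}.
Variables (M : mdp R S A) (phi : S -> Sb) (rho : S -> A).
Implicit Types (f g h : S -> R) (b c : Sb) (x y : S).

(** The transition operator of the chain killed unless it lands in [b]. Its iterate [stay b k f x]
    is the expectation of f(s_k) on the event that s_1, ..., s_k lie in [b]; a single [next_in c]
    accounts for the entry into another block. *)
Definition next_in b f x : R := next M rho (fun y => (phi y == b)%:R * f y) x.

Definition stay b (k : nat) f : S -> R := iter k (next_in b) f.

Lemma bounded_real_next_in b f : bounded_real f -> bounded_real (next_in b f).
Proof. by move=> bf; apply: bounded_real_next; exact: bounded_realM. Qed.

Lemma bounded_real_stay b k f : bounded_real f -> bounded_real (stay b k f).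
Proof. by move=> bf; elim: k => //= k; exact: bounded_real_next_in. Qed.

Lemma ler_next_in b f g x : bounded_real f -> bounded_real g ->
  (forall y, 0 < trans M x (rho x) y -> phi y = b -> f y <= g y) ->
  next_in b f x <= next_in b g x.
Proof.
move=> bf bg fg; apply: ler_next => [||y Ty]; [exact: bounded_realM..|].
by case: eqP => [yb|_]; rewrite ?mul1r ?mul0r// fg.
Qed.

Lemma eq_next_in b f g x : bounded_real f -> bounded_real g ->
  (forall y, phi y = b -> f y = g y) -> next_in b f x = next_in b g x.
Proof.
by move=> bf bg fg; apply/le_anti/andP; split;
  apply: ler_next_in => // y _ /fg ->.
Qed.

Lemma next_inD b f g x : bounded_real f -> bounded_real g ->
  next_in b (fun y => f y + g y) x = next_in b f x + next_in b g x.
Proof.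
move=> bf bg; rewrite /next_in -nextD; [|exact: bounded_realM..].
by apply: next_ext => y; rewrite mulrDr.
Qed.

Lemma next_inZ b a f x : bounded_real f ->
  next_in b (fun y => a * f y) x = a * next_in b f x.
Proof.
move=> bf; rewrite /next_in -nextZ; last exact: bounded_realM.
by apply: next_ext => y; rewrite mulrCA.
Qed.

Lemma next_in_sum b (P : pred Sb) (F : Sb -> S -> R) x :
  (forall i, bounded_real (F i)) ->
  next_in b (fun y => \sum_(i | P i) F i y) x =
  \sum_(i | P i) next_in b (F i) x.
Proof.
move=> bF; rewrite /next_in -next_sum; last first.
  by move=> i; apply: bounded_realM.
by apply: next_ext => y; rewrite mulr_sumr.
Qed.

Lemma next_split f x : bounded_real f ->
  next M rho f x = \sum_c next_in c f x.
Proof.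
move=> bf; rewrite /next_in -next_sum; last first.
  by move=> i; apply: bounded_realM.
apply: next_ext => y.
rewrite (bigD1 (phi y))//= eqxx mul1r big1 ?addr0// => c /negPf.
by rewrite eq_sym => ->; rewrite mul0r.
Qed.

(** All states where [f] and [g] are evaluated lie in [b]: by confinement after a step, and by
    [phi x = b] when [k = 0]. *)
Lemma ler_stay b k f g x : bounded_real f -> bounded_real g ->
  (forall y, phi y = b -> f y <= g y) -> phi x = b ->
  stay b k f x <= stay b k g x.
Proof.
move=> bf bg fg; elim: k x => [|k IHk] x xb; first exact: fg.
by apply: ler_next_in => [||y _ yb]; [exact: bounded_real_stay..|exact: IHk].
Qed.

Lemma stayD b k f g x : bounded_real f -> bounded_real g ->
  stay b k (fun y => f y + g y) x = stay b k f x + stay b k g x.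
Proof.
move=> bf bg; elim: k x => [//|k IHk] x /=.
by rewrite (funext IHk) next_inD//; exact: bounded_real_stay.
Qed.

Lemma stayZ b k a f x : bounded_real f ->
  stay b k (fun y => a * f y) x = a * stay b k f x.
Proof.
move=> bf; elim: k x => [//|k IHk] x /=.
by rewrite (funext IHk) next_inZ//; exact: bounded_real_stay.
Qed.

Lemma stay_itv b k f x : bounded_real f ->
  (forall y, 0 <= f y <= 1) -> 0 <= stay b k f x <= 1.
Proof.
move=> bf f01; elim: k x => [|k IHk] x; first exact: f01.
have bs := bounded_real_stay b k bf.
apply/andP; split.
  rewrite -[leLHS](next_cst M rho 0 x); apply: ler_next => // [|y _].
    exact: bounded_realM.
  by have /andP[s0 _] := IHk y; rewrite mulr_ge0.
rewrite -[leRHS](next_cst M rho 1 x); apply: ler_next => // [|y _].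
  exact: bounded_realM.
have /andP[_ s1] := IHk y.
by case: eqP => _; rewrite ?mul1r ?mul0r ?ler01.
Qed.

(** The block [b] and the default [d] are fixed instead of being read off the start [x], because the
    start moves in the induction. *)
Lemma expect_stay b c d k x :
  expect M rho k.+1 x (fun w =>
    (all (fun u => phi u == b) (take k w) && (phi (nth d w k) == c))%:R) =
  stay b k (next_in c (fun=> 1)) x.
Proof.
elim: k x => [|k IHk] x.
  by congr dsum; apply/funext => y /=; rewrite mulr1.
rewrite expectS; apply: next_ext => y.
rewrite -[RHS]/((phi y == b)%:R * stay b k (next_in c (fun=> 1)) y).
rewrite -IHk -[RHS]add0r -expect_affine; last first.
  exact: bounded_real_nat.
apply: (congr1 (expect M rho k.+1 y)); apply/funext => w; rewrite add0r /=.
by case: (phi y == b); rewrite ?mul1r ?mul0r.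
Qed.

Lemma exit_probE x c k :
  exit_prob M phi rho x c k = stay (phi x) k (next_in c (fun=> 1)) x.
Proof. exact: expect_stay. Qed.

(* One exit equation, iterated: with h the reward-plus-continuation and
   a the discount it expands a value function over the exit times, and with
   h = f = 1 and a = 1 it bounds the total exit probability. *)
Lemma stay_telescope b h f a n x : bounded_real h -> bounded_real f ->
  (forall y, phi y = b ->
    f y = \sum_(c | c != b) next_in c h y + a * next_in b f y) ->
  phi x = b ->
  \sum_(k < n) a ^+ k * \sum_(c | c != b) stay b k (next_in c h) x =
  f x - a ^+ n * stay b n f x.
Proof.
move=> bh bf fE.
have bX c k : bounded_real (stay b k (next_in c h)).
  by apply: bounded_real_stay; exact: bounded_real_next_in.
(* The exit equation after [k] confined steps; its last term is [a] times the left side at [k + 1],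
   so the weighted sum telescopes. *)
have stayE k y : phi y = b -> stay b k f y =
    \sum_(c | c != b) stay b k (next_in c h) y + a * stay b k.+1 f y.
  elim: k y => [|k IHk] y yb; first exact: fE.
  have bs j := bounded_real_stay b j bf.
  have bsum : bounded_real
      (fun y => \sum_(c | c != b) stay b k (next_in c h) y).
    by apply: bounded_real_sum => c; exact: bX.
  have bas : bounded_real (fun y => a * stay b k.+1 f y).
    exact: bounded_realM.
  transitivity (next_in b (fun z =>
      \sum_(c | c != b) stay b k (next_in c h) z + a * stay b k.+1 f z) y).
    by apply: eq_next_in; [exact: (bs k)|exact: bounded_realD|exact: IHk].
  rewrite next_inD// next_in_sum// next_inZ//; exact: (bs k.+1).
move=> xb; elim: n => [|n IHn]; first by rewrite big_ord0 expr0 mul1r subrr.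
by rewrite big_ord_recr/= IHn (stayE n x xb) exprSr /=; ring.
Qed.

End Blocks.

#[local] Hint Resolve bounded_real_next_in bounded_real_stay : core.

(** * Exit probabilities and values at exit *)

Section Exits.
#[local] Set Implicit Arguments.
#[local] Unset Strict Implicit.
Context {R : realType} {S : choiceType} {A : Type} {Sb : finType}.
Variables (M : mdp R S A) (phi : S -> Sb).
Local Notation gamma := (discount M).
Implicit Types (rho : S -> A) (f g h : S -> R) (b c : Sb) (x y : S).

Let gamma0 : 0 < gamma := discount_gt0 M.
Let gamma1 : gamma < 1 := discount_lt1 M.

Lemma stay_exit_itv rho b c k x :
  0 <= stay M phi rho b k (next_in M phi rho c (fun=> 1)) x <= 1.
Proof.
apply: stay_itv => [|y]; first exact: bounded_real_next_in.
by apply: (stay_itv M phi rho c 1) => // z; rewrite ler01 lexx.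
Qed.

(** By monotonicity [h] may be replaced by the constants [a - e] and [a + e], which factor out and
    leave the exit probability. *)
Lemma stay_exit_approx rho b c k h a e x : bounded_real h ->
  (forall y z, phi y = b -> 0 < trans M y (rho y) z -> phi z = c ->
    a - e <= h z <= a + e) ->
  phi x = b ->
  (a - e) * stay M phi rho b k (next_in M phi rho c (fun=> 1)) x <=
    stay M phi rho b k (next_in M phi rho c h) x <=
    (a + e) * stay M phi rho b k (next_in M phi rho c (fun=> 1)) x.
Proof.
move=> bh hae xb.
have bX r : bounded_real (next_in M phi rho c (fun=> r)).
  exact: bounded_real_next_in.
have stayE r : r * stay M phi rho b k (next_in M phi rho c (fun=> 1)) x =
    stay M phi rho b k (next_in M phi rho c (fun=> r)) x.
  rewrite -stayZ//; congr (stay _ _ _ _ _ _ _); apply/funext => y.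
  by rewrite -next_inZ//; apply: next_ext => z; rewrite mulr1.
have bXh := bounded_real_next_in M phi rho c bh.
by rewrite !stayE; apply/andP; split; apply: ler_stay => // y yb;
  apply: ler_next_in => // z Tz zc; have /andP[] := hae y z yb Tz zc.
Qed.

(** By [stay_exit_approx] the difference is at most (a + e) p1 - (a - e) p2 = a (p1 - p2) + e (p1 +
    p2), where a, p1 and p2 lie in [0, 1]. *)
Lemma stay_exit_diff rho1 rho2 b c k h a e eps x : bounded_real h ->
  0 <= a <= 1 -> 0 <= e ->
  (forall y z (u : A), phi y = b -> 0 < trans M y u z -> phi z = c ->
    a - e <= h z <= a + e) ->
  phi x = b ->
  `|stay M phi rho1 b k (next_in M phi rho1 c (fun=> 1)) x -
    stay M phi rho2 b k (next_in M phi rho2 c (fun=> 1)) x| <= eps ->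
  stay M phi rho1 b k (next_in M phi rho1 c h) x -
    stay M phi rho2 b k (next_in M phi rho2 c h) x <= eps + 2 * e.
Proof.
move=> bh /andP[a0 a1] e0 hae xb p12.
have [_ ub1] := andP (stay_exit_approx k bh (fun y z => hae y z (rho1 y)) xb).
have [lb2 _] := andP (stay_exit_approx k bh (fun y z => hae y z (rho2 y)) xb).
have /andP[p10 p11] := stay_exit_itv rho1 b c k x.
have /andP[p20 p21] := stay_exit_itv rho2 b c k x.
move: p12 ub1 lb2 p10 p11 p20 p21.
set p1 := stay _ _ rho1 _ _ (next_in _ _ _ _ (fun=> 1)) _.
set p2 := stay _ _ rho2 _ _ (next_in _ _ _ _ (fun=> 1)) _.
set u1 := stay _ _ rho1 _ _ _ _; set u2 := stay _ _ rho2 _ _ _ _.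
move=> p12 ub1 lb2 p10 p11 p20 p21.
have h1 : a * (p1 - p2) <= eps.
  apply: le_trans p12; apply: le_trans (ler_norm _) _.
  by rewrite normrM ger0_norm// ler_piMl.
have h2 : e * p1 <= e by rewrite ler_piMr.
have h3 : e * p2 <= e by rewrite ler_piMr.
lra.
Qed.

(** Without discounting, the sum telescopes to 1 minus the probability of staying [n] steps in [b];
    discounting only lowers it. *)
Lemma total_exit_le1 rho b n x : phi x = b ->
  \sum_(k < n) gamma ^+ k * \sum_(c | c != b)
    stay M phi rho b k (next_in M phi rho c (fun=> 1)) x <= 1.
Proof.
move=> xb; have b1 := bounded_real_cst (1 : R) (S := S).
have one_split y : phi y = b -> 1 =
    \sum_(c | c != b) next_in M phi rho c (fun=> 1) y +
    1 * next_in M phi rho b (fun=> 1) y.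
  move=> _; rewrite -[LHS](next_cst M rho 1 y) (next_split M phi rho y b1).
  by rewrite (bigD1 b)//= addrC mul1r.
have telescope := stay_telescope (a := 1) n b1 b1 one_split xb.
apply: (@le_trans _ _ (\sum_(k < n) 1 ^+ k * \sum_(c | c != b)
    stay M phi rho b k (next_in M phi rho c (fun=> 1)) x)).
  apply: ler_sum => k _; apply: ler_wpM2r.
    by apply: sumr_ge0 => c _; have /andP[] := stay_exit_itv rho b c k x.
  by rewrite expr1n exprn_ile1// ltW.
rewrite telescope expr1n mul1r gerBl.
have /(_ _)/andP[] // := stay_itv M phi rho b n x b1.
by move=> y; rewrite ler01 lexx.
Qed.

Section GoalExits.
Variables (G : set S) (Gb : set Sb).
Hypotheses (goalM : goal_mdp M G)
  (GE : G = \bigcup_(sb in Gb) (phi @^-1` [set sb])).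

(** Rewards thus depend only on the blocks left and entered, and a move inside a block earns
    none. *)
Lemma goal_block y : (y \in G) = (phi y \in Gb).
Proof.
apply/idP/idP; rewrite GE => /set_mem.
  by case=> c Gc /= yc; apply/mem_set; rewrite yc.
by move=> Gy; apply/mem_set; exists (phi y).
Qed.

(* Reward collected on entering y from outside the goal, plus continuation. *)
Definition entry_value rho y : R := (y \in G)%:R + gamma * value M rho y.

Lemma bounded_real_entry_value rho : bounded_real (entry_value rho).
Proof.
apply: bounded_realD; first exact: bounded_real_nat.
apply: bounded_realM => //.
exact: bounded_real_value (goal_reward01 goalM).
Qed.

Lemma value_exit_expansion rho b n x : b \notin Gb -> phi x = b ->
  \sum_(k < n) gamma ^+ k * \sum_(c | c != b)
    stay M phi rho b k (next_in M phi rho c (entry_value rho)) x =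
  value M rho x - gamma ^+ n * stay M phi rho b n (value M rho) x.
Proof.
move=> bG xb; have bV := bounded_real_value rho (goal_reward01 goalM).
have bh := bounded_real_entry_value rho.
apply: stay_telescope => // y yb.
rewrite (value_bellman _ (goal_reward01 goalM)).
(* Outside the goal the reward is the indicator of arriving in [G], so reward plus continuation is
   the entry value. *)
transitivity (next M rho (entry_value rho) y).
  by apply: next_ext => z; rewrite goalM.1 goal_block yb bG.
rewrite (next_split M phi)// (bigD1 b)//= addrC; congr (_ + _).
rewrite -next_inZ//; apply: eq_next_in => // [|z zb].
  exact: bounded_realM.
by rewrite /entry_value goal_block zb (negPf bG) add0r.
Qed.

End GoalExits.
End Exits.

(** * The loss at a single state *)

Lemma ler_dist_clamp01 {R : realDomainType} (w v : R) :
  0 <= v <= 1 -> `|Num.max 0 (Num.min 1 w) - v| <= `|w - v|.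
Proof.
move=> /andP[v0 v1]; have [w0|/ltW w0] := leP w 0.
  rewrite (min_r (le_trans w0 ler01)) (max_l w0) sub0r normrN ger0_norm//.
  by rewrite ler0_norm ?subr_le0 ?(le_trans w0)// opprB lerDl oppr_ge0.
have [w1|/ltW w1] := leP w 1; first by rewrite max_r.
rewrite max_r// !ger0_norm ?subr_ge0// ?lerB//.
exact: le_trans w1.
Qed.

(** A self-referential estimate: the uniform bound [D] on the loss comes back with a factor below 1,
    so that it can be solved for [D]. *)
Lemma state_loss (R : realType) (S : choiceType) (A : Type) (Sb : finType)
    (M : mdp R S A) (phi : S -> Sb) (G : set S) (Gb : set Sb)
    (rho_opt rho : S -> A) (eps nu D : R) (s : S) :
  goal_mdp M G ->
  G = \bigcup_(sb in Gb) (phi @^-1` [set sb]) ->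
  optimal_policy M rho_opt ->
  0 <= eps ->
  abstract_similarity M phi rho_opt rho eps ->
  approximates_value M phi nu ->
  (forall y, value M rho_opt y - value M rho y <= D) ->
  value M rho_opt s - value M rho s <=
    #|Sb|%:R * (eps + 2 * (discount M * nu)) / (1 - discount M) +
    discount M * D.
Proof.
move=> goalM GE opt eps0 sim [nu0 [W WV]] VD.
set gamma := discount M.
have gamma0 : 0 < gamma := discount_gt0 M.
have gamma1 : gamma < 1 := discount_lt1 M.
have reward01 := goal_reward01 goalM.
have value01 r y : 0 <= value M r y <= 1.
  rewrite (goal_value_le1 goalM) andbT.
  by have /andP[] := value_itv r reward01 y.
have D0 : 0 <= D.
  by apply: le_trans (VD s); rewrite subr_ge0 opt (goal_value_le_opt goalM).
have e0 : 0 <= gamma * nu by rewrite mulr_ge0// ltW.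
set B := eps + 2 * (gamma * nu).
have B0 : 0 <= B by rewrite addr_ge0// mulr_ge0.
have bound0 : 0 <= #|Sb|%:R * B / (1 - gamma) + gamma * D.
  by rewrite addr_ge0// ?divr_ge0 ?mulr_ge0// ?subr_ge0 ltW.
have [Gs|nGs] := pselect (G s).
  by rewrite !(goal_value0 goalM _ Gs) subrr.
set b := phi s; have bG : b \notin Gb.
  by rewrite -(goal_block GE); apply/negP => /set_mem.
set V := value M rho_opt; set Vr := value M rho.
have bV : bounded_real V by exact: bounded_real_value.
have bVr : bounded_real Vr by exact: bounded_real_value.
pose h := entry_value M G rho_opt; pose hr := entry_value M G rho.
have bh : bounded_real h by exact: bounded_real_entry_value.
have bhr : bounded_real hr by exact: bounded_real_entry_value.
pose p k c := stay M phi rho b k (next_in M phi rho c (fun=> 1)) s.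
(* The constant is 1 for a goal block, where the reward is 1 and the continuation 0. Otherwise it is
   [gamma] times [W b c] clamped to [0, 1], so that it lies in [0, 1] as [stay_exit_diff]
   demands. *)
have entry_approx c y z (u : A) : phi y = b -> 0 < trans M y u z -> phi z = c ->
    let a := if c \in Gb then 1
             else gamma * Num.max 0 (Num.min 1 (W b c)) in
    a - gamma * nu <= h z <= a + gamma * nu.
  move=> yb T0 zc; rewrite /= /h /entry_value (goal_block GE) zc.
  case: ifPn => cG.
    rewrite (goal_value0 goalM); first by rewrite mulr0 addr0 gerBl lerDl e0.
    by apply/set_mem; rewrite (goal_block GE) zc.
  rewrite add0r -mulrBr -mulrDr !ler_pM2l// -ler_distlC.
  (* Values lie in [0, 1], so clamping [W b c] does not increase its error. *)
  apply: le_trans (ler_dist_clamp01 _ _ (value01 rho_opt z)) _.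
  by rewrite opt; exact: WV T0.
have exit_diff k c : c != b ->
    stay M phi rho_opt b k (next_in M phi rho_opt c h) s -
    stay M phi rho b k (next_in M phi rho c hr) s <= B + gamma * D * p k c.
  move=> cb.
  have bX f : bounded_real f -> bounded_real (next_in M phi rho c f).
    exact: bounded_real_next_in.
  (* Pointwise [h] exceeds [hr] by at most [gamma * D], an excess weighted here by the exit
     probability. *)
  have value_change : stay M phi rho b k (next_in M phi rho c h) s <=
      stay M phi rho b k (next_in M phi rho c hr) s + gamma * D * p k c.
    have bDX : bounded_real
        (fun y => gamma * D * next_in M phi rho c (fun=> 1) y).
      by apply: bounded_realM => //; exact: bX.
    rewrite -stayZ -?stayD//; [|exact: bX..].
    apply: ler_stay => // [||y _]; first exact: bX.
      by apply: bounded_realD => //; exact: bX.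
    rewrite -next_inZ// -next_inD//.
    apply: ler_next_in => // [|z _ _].
      by apply: bounded_realD => //; exact: bounded_realM.
    rewrite mulr1 /h /hr /entry_value -addrA lerD2l -mulrDr ler_pM2l//.
    by rewrite -lerBlDl.
  have policy_diff : stay M phi rho_opt b k (next_in M phi rho_opt c h) s -
      stay M phi rho b k (next_in M phi rho c h) s <= B.
    apply: (stay_exit_diff bh _ e0 (entry_approx c)) => //.
      case: ifP => _; first by rewrite ler01 lexx.
      have c0 : 0 <= Num.max 0 (Num.min 1 (W b c)) by rewrite le_max lexx.
      have c1 : Num.max 0 (Num.min 1 (W b c)) <= 1.
        by rewrite ge_max ler01 ge_min lexx.
      by rewrite mulr_ge0 ?(ltW gamma0)//= mulr_ile1// ltW.
    by rewrite -!exit_probE; exact: sim.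
  lra.
have geom n : \sum_(k < n) gamma ^+ k <= (1 - gamma)^-1.
  rewrite -[leRHS]mul1r ler_pdivlMr ?subr_gt0// mulrC -opprB mulNr -subrX1.
  by rewrite opprB gerBl exprn_ge0// ltW.
(* Both expansions are cut after [n] exit times: the optimal remainder is at most [gamma ^+ n], and
   the other one has the favourable sign. *)
apply: (@le_discount_limit _ _ _ M _ _ 1) => n.
have Vn := value_exit_expansion goalM GE rho_opt n bG (erefl b).
have Vrn := value_exit_expansion goalM GE rho n bG (erefl b).
have restV : gamma ^+ n * stay M phi rho_opt b n V s <= gamma ^+ n * 1.
  rewrite ler_wpM2l ?exprn_ge0 ?(ltW gamma0)//.
  by have /andP[] := stay_itv M phi rho_opt b n s bV (value01 rho_opt).
have restVr : 0 <= gamma ^+ n * stay M phi rho b n Vr s.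
  rewrite mulr_ge0 ?exprn_ge0 ?(ltW gamma0)//.
  by have /andP[] := stay_itv M phi rho b n s bVr (value01 rho).
have main : \sum_(k < n) gamma ^+ k * \sum_(c | c != b)
      stay M phi rho_opt b k (next_in M phi rho_opt c h) s -
    \sum_(k < n) gamma ^+ k * \sum_(c | c != b)
      stay M phi rho b k (next_in M phi rho c hr) s <=
    #|Sb|%:R * B / (1 - gamma) + gamma * D.
  (* The policy change costs at most [B] for each of at most [#|Sb|] blocks, summed geometrically
     over [k]; the continuation cost is summed against the exit probabilities. *)
  rewrite -sumrB; apply: (@le_trans _ _ (\sum_(k < n)
    (gamma ^+ k * (#|Sb|%:R * B) +
     gamma * D * (gamma ^+ k * \sum_(c | c != b) p k c)))).
    apply: ler_sum => k _; rewrite -mulrBr -sumrB [X in _ + X]mulrCA -mulrDr.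
    rewrite ler_wpM2l ?exprn_ge0 ?(ltW gamma0)//.
    rewrite mulr_sumr.
    apply: (@le_trans _ _ (\sum_(c | c != b) (B + gamma * D * p k c))).
      by apply: ler_sum => c cb; exact: exit_diff.
    rewrite big_split/= lerD2r sumr_const mulr_natl.
    by rewrite ler_wpMn2l// max_card.
  rewrite big_split/= -mulr_suml -mulr_sumr lerD//.
    by rewrite mulrC ler_wpM2l ?geom// mulr_ge0.
  rewrite -[leRHS]mulr1 ler_wpM2l ?mulr_ge0 ?(ltW gamma0)//.
  exact: total_exit_le1.
move: main; rewrite Vn Vrn -/V -/Vr; lra.
Qed.

(** * Passage to the supremum over all states *)

Theorem theorem1 (R : realType) (S : choiceType) (A : Type)
    (Sb : finType) (Ab : Type)
    (M : mdp R S A) (Mb : mdp R Sb Ab) (phi : S -> Sb)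
    (G : set S) (Gb : set Sb)
    (rho_opt rho_b : S -> A) (eps nu : R) :
  goal_mdp M G ->
  goal_mdp Mb Gb ->
  G = \bigcup_(sb in Gb) (phi @^-1` [set sb]) ->
  optimal_policy M rho_opt ->
  optimal_policy (biased_mdp M Mb phi) rho_b ->
  0 <= eps ->
  abstract_similarity M phi rho_opt rho_b eps ->
  abstract_value_approximation M phi nu ->
  exploration_loss M rho_b <=
    2 * #|Sb|%:R * (eps + discount M * nu) / (1 - discount M) ^+ 2.
Proof.
move=> goalM _ GE opt _ eps0 sim [approx _].
have gamma0 := discount_gt0 M; have gamma1 := discount_lt1 M.
have gap0 : 0 < 1 - discount M by rewrite subr_gt0.
have lossE s : `|opt_value M s - value M rho_b s| =
    value M rho_opt s - value M rho_b s.
  by rewrite -opt ger0_norm// subr_ge0 opt (goal_value_le_opt goalM).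
pose D := exploration_loss M rho_b.
have lossD s : value M rho_opt s - value M rho_b s <= D.
  rewrite -lossE; apply: ub_le_sup; last by exists s.
  (* Values lie in [0, 1], so the losses are bounded and their supremum is an upper bound. *)
  exists 1 => _ [y _ <-]; rewrite lossE lerBlDr.
  apply: le_trans (goal_value_le1 goalM rho_opt y) _; rewrite lerDl.
  by have /andP[] := value_itv rho_b (goal_reward01 goalM) y.
set C := #|Sb|%:R * (eps + 2 * (discount M * nu)) / (1 - discount M).
have C0 : 0 <= C.
  have nu0 := approx.1.
  rewrite divr_ge0 ?(ltW gap0)// mulr_ge0// addr_ge0// mulr_ge0//.
  by rewrite mulr_ge0// ltW.
(* The supremum of [state_loss] over the states reads D <= C + gamma D. *)
have DC : D * (1 - discount M) <= C.
  rewrite mulrBr mulr1 lerBlDr [D * _]mulrC.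
  have [[s _]|/set0P/negP/negPn/eqP S0] := pselect ([set: S] !=set0).
    apply: ge_sup; first by eexists; exists s.
    move=> _ [y _ <-]; rewrite lossE.
    by apply: (@state_loss _ _ _ _ M phi G Gb rho_opt rho_b).
  (* Without states the loss is the supremum of the empty set, 0 by default. *)
  have -> : D = 0 by rewrite /D /exploration_loss S0 image_set0 sup0.
  by rewrite mulr0 addr0.
rewrite expr2 invfM mulrA ler_pdivlMr//; apply: le_trans DC _.
rewrite ler_wpM2r ?invr_ge0 ?(ltW gap0)//.
have -> : 2 * #|Sb|%:R * (eps + discount M * nu) =
    #|Sb|%:R * (2 * eps + 2 * (discount M * nu)) by ring.
(* The slack in the final bound is that of [eps <= 2 * eps]. *)
by rewrite ler_wpM2l// lerD2r mulr_natl mulr2n lerDl.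
Qed.
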